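(* For every election $(V,A,\succ)$ with $n=|V|\ge 1$ voters, every integer $k\ge 1$ and every $\beta\in[0,1]$, there exists a set $C\subseteq A$ with $|C|\le k$ that is $\big(\beta+(1-\beta)^k\big)$-undominated, i.e. for every $a\in A\setminus C$, $$\big|\{v\in V: a\succ_v C\}\big|\le \big\lfloor (\beta+(1-\beta)^k)\, n\big\rfloor .$$
   Context: An election $(V,A,\succ)$ consists of a finite nonempty set $V$ of $n$ voters, a finite nonempty set $A$ of candidates, and for each voter $v$ a strict linear order $\succ_v$ on $A$; $a\succeq_v b$ means $a=b$ or $a\succ_v b$. For $C\subseteq A$ and $a\in A\setminus C$, $a\succ_v C$ means $a\succ_v c$ for all $c\in C$. For $\alpha\ge 0$, a set $C\subseteq A$ is $\alpha$-undominated if $|\{v\in V: a\succ_v C\}|\le\lfloor \alpha n\rfloor$ for every $a\in A\setminus C$. *)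

(* Defs.v *)
From mathcomp Require Import all_boot all_order all_algebra.
From mathcomp Require Import reals.
Set Implicit Arguments. Unset Strict Implicit. Unset Printing Implicit Defensive.
Import Order.TTheory GRing.Theory Num.Theory.
Local Open Scope ring_scope.

Definition strict_linear_order (A : finType) (r : rel A) : Prop :=
  irreflexive r /\ transitive r /\ (forall a b, a != b -> r a b || r b a).

(* An election: voters V, candidates A (both finite, nonempty), and for each
   voter v a strict linear order  pref v  (pref v a b  means  a >_v b). *)
Definition election (V A : finType) (pref : V -> rel A) : Prop :=
  (0 < #|V|)%N /\ (0 < #|A|)%N /\ forall v, strict_linear_order (pref v).

Definition prefers_to_set (V A : finType) (pref : V -> rel A) (v : V) (a : A)
  (C : {set A}) : bool := [forall c in C, pref v a c].

Definition undominated (R : realType) (V A : finType) (pref : V -> rel A)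
  (alpha : R) (C : {set A}) : Prop :=
  forall a, a \notin C ->
    (#|[set v | prefers_to_set pref v a C]|%:Z <= Num.floor (alpha * #|V|%:R))%R.

(* Main.v *)
(** Call a distribution w on the candidates a Lindahl equilibrium if each
    candidate a satisfies w {c | c >=_v a} < beta for at most beta n voters v.
    In any distribution, the candidates that v ranks below no a with
    w {c | c >=_v a} >= beta have total mass at least beta. Picking k candidates
    greedily hits these sets for all but (1 - beta)^k n voters, and a voter v
    whose set is hit prefers a to all picked candidates only if
    w {c | c >=_v a} < beta, which in an equilibrium holds for at most beta n
    voters.

    Equilibria come from Scarf's lemma for the 0-1 matrix with a row for each
    voter and a column for each pair of a candidate a and a coalition S of more
    than beta n voters: the column (a, S) is dominated at some v in S whose row
    is tight, so w {c | c >=_v a} >= beta for this v. Scarf's lemma is in turn a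
    parity argument: the dominant sets and the set of slacks form a cycle modulo
    2 in a full simplex, the feasible bases of a generic system form a cocycle,
    and the two meet in an even number of sets, one of which is the set of
    slacks. *)
Require Import Defs.
From mathcomp Require Import all_boot all_order all_algebra.
From mathcomp Require Import boolp reals.
From mathcomp Require Import zify ring lra.
Import Order.TTheory GRing.Theory Num.Theory.
Local Open Scope ring_scope.

Set Implicit Arguments.
Unset Strict Implicit.

(** * Cycles and cocycles modulo 2 *)

Lemma odd_sum (J : finType) (S : pred J) (F : J -> nat) :
  odd (\sum_(j | S j) F j) = \big[addb/false]_(j | S j) odd (F j).
Proof. exact: (big_morph odd oddD). Qed.

Section CycleCocycle.
Variable T : finType.
Implicit Types (E P Q : {set T}) (Z B : {set {set T}}).

Definition cofaces Z E := [set x | (x \notin E) && (x |: E \in Z)].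
Definition facets B Q := [set x in Q | Q :\ x \in B].

Definition mod2_cycle Z := forall E, ~~ odd #|cofaces Z E|.
Definition mod2_cocycle B := forall Q, ~~ odd #|facets B Q|.

Lemma exchange_facets_cofaces (Z B : {set {set T}}) :
  (\sum_(P in Z) #|facets B P| = \sum_(E in B) #|cofaces Z E|)%N.
Proof.
under eq_bigr do rewrite -sum1_card; under [RHS]eq_bigr do rewrite -sum1_card.
rewrite !pair_big_dep /=.
rewrite (reindex_onto (fun p : {set T} * T => (p.2 |: p.1, p.2))
                      (fun p => (p.1 :\ p.2, p.2))) /=; last first.
  by case=> P x /=; rewrite inE => /and3P[_ xP _]; rewrite setD1K.
apply: eq_bigl => -[E x] /=; rewrite xpair_eqE eqxx andbT !inE eqxx /=.
have [xE|xE] := boolP (x \in E); last by rewrite setU1K // eqxx andbT andbC.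
rewrite andbF; apply/negP => /andP[_ /eqP xE_x].
by have := setD11 x (x |: E); rewrite xE_x xE.
Qed.

Section Apex.
Variable t0 : T.

Definition link B := [set E : {set T} | (t0 \notin E) && (t0 |: E \in B)].
Definition deletion Z := [set P : {set T} in Z | t0 \notin P].

Lemma odd_facets_link B P :
  mod2_cocycle B -> t0 \notin P -> odd #|facets (link B) P| = (P \in B).
Proof.
move=> cocB t0P; have := cocB (t0 |: P).
rewrite (cardsD1 t0) inE setU11 setU1K // oddD oddb.
rewrite (_ : _ :\ t0 = facets (link B) P); first by case: (P \in B); case: odd.
apply/setP => x; rewrite !inE; case: eqVneq => [->|xt0] /=.
  by rewrite (negbTE t0P).
have -> : (t0 |: P) :\ x = t0 |: P :\ x.
  by apply/setP => y; rewrite !inE; case: eqVneq => // ->; rewrite (negbTE xt0).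
by rewrite (negbTE t0P).
Qed.

Lemma odd_cofaces_deletion Z E :
  mod2_cycle Z -> t0 \notin E ->
  odd #|cofaces (deletion Z) E| = (t0 |: E \in Z).
Proof.
move=> cycZ t0E; have := cycZ E; rewrite (cardsD1 t0) inE t0E oddD oddb.
rewrite (_ : _ :\ t0 = cofaces (deletion Z) E).
  by case: (_ \in Z); case: odd.
apply/setP => x; rewrite !inE negb_or t0E andbT.
by rewrite eq_sym; case: (x \in E); case: (_ \in Z); case: eqVneq.
Qed.

End Apex.

(* Z is the boundary of its cone with apex t0, and B vanishes on boundaries. *)
Lemma even_cycleI_cocycle (t0 : T) Z B :
  mod2_cycle Z -> mod2_cocycle B -> ~~ odd #|Z :&: B|.
Proof.
move=> cycZ cocB; rewrite -(cardsID [set P : {set T} | t0 \in P]) oddD.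
have -> : odd #|Z :&: B :&: [set P : {set T} | t0 \in P]| =
          odd (\sum_(E in link t0 B) #|cofaces (deletion t0 Z) E|).
  rewrite -sum1_card !odd_sum.
  rewrite (reindex_onto (fun E => t0 |: E) (fun P => P :\ t0)) /=.
    rewrite [RHS]big_mkcond [LHS]big_mkcond; apply: eq_bigr => E _.
    rewrite !inE eqxx /=.
    have [t0E|t0E] /= := boolP (t0 \in E).
      by case: eqP => [defE|_]; [rewrite -defE setD11 in t0E | rewrite andbF].
    rewrite setU1K // eqxx odd_cofaces_deletion // !andbT.
    by case: (_ \in Z); case: (_ \in B).
  by move=> P; rewrite !inE => /andP[_ ?]; rewrite setD1K.
rewrite -exchange_facets_cofaces -sum1_card !odd_sum.
rewrite [X in X (+) _]big_mkcond [X in _ (+) X]big_mkcond -big_split /=.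
rewrite big1 // => P _; rewrite !inE.
have [t0P|t0P] /= := boolP (t0 \in P); first by rewrite andbF.
by rewrite odd_facets_link // andbT; case: (P \in Z); case: (P \in B).
Qed.

End CycleCocycle.

(** * Dominant sets *)

Section Dominance.
Variables (I T : finType) (key : I -> T -> nat).
Hypothesis key_inj : forall i, injective (key i).
Implicit Types (D E : {set T}).

Definition dominant D :=
  [forall y, exists i, [forall d in D, (key i y <= key i d)%N]].

Lemma dominantP D :
  reflect (forall y, exists i, forall d, d \in D -> (key i y <= key i d)%N)
          (dominant D).
Proof.
apply: (iffP forallP) => dom y; have := dom y.
  by case/existsP => i /forall_inP; exists i.
by case=> i y_le; apply/existsP; exists i; apply/forall_inP.
Qed.

Lemma dominantS D E : D \subset E -> dominant E -> dominant D.
Proof.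
move=> /subsetP sDE /dominantP domE; apply/dominantP => y.
by have [i y_le] := domE y; exists i => d /sDE; apply: y_le.
Qed.

Definition lowest D i d :=
  d \in D /\ forall e, e \in D -> (key i d <= key i e)%N.

Lemma lowest_unique D i d e : lowest D i d -> lowest D i e -> d = e.
Proof.
case=> dD d_le [eD e_le]; apply: (@key_inj i); apply/eqP.
by rewrite eqn_leq d_le ?e_le.
Qed.

Lemma lowestS D E i d : D \subset E -> d \in D -> lowest E i d -> lowest D i d.
Proof. by move=> /subsetP sDE dD [_ d_le]; split=> // e /sDE; apply: d_le. Qed.

Lemma exists_lowest D : D != set0 -> exists mn, forall i, lowest D i (mn i).
Proof.
case/set0Pn => d0 d0D; exists (fun i => [arg min_(d < d0 in D) key i d]%N) => i.
by case: arg_minnP => // d dD d_le; split.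
Qed.

Lemma lowest_onto D mn :
  dominant D -> (forall i, lowest D i (mn i)) -> mn @: [set: I] = D.
Proof.
move=> /dominantP domD low; apply/eqP; rewrite eqEsubset; apply/andP; split.
  by apply/subsetP => _ /imsetP[i _ ->]; case: (low i).
apply/subsetP => d dD; have [i d_le] := domD d.
by rewrite -(lowest_unique (low i) (conj dD d_le)) imset_f.
Qed.

Definition extensions E := [set x | (x \notin E) && dominant (x |: E)].

Section Extensions.
Variables (E : {set T}) (mn : I -> T) (j k : I).
Hypothesis domE : dominant E.
Hypothesis cardE : #|E|.+1 = #|I|.
Hypothesis mn_low : forall i, lowest E i (mn i).
Hypothesis neq_jk : j != k.
Hypothesis mn_jk : mn j = mn k.

Definition above l :=
  [set y | [forall (i | i != l), (key i (mn i) < key i y)%N]].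

Lemma aboveP l y :
  reflect (forall i, i != l -> (key i (mn i) < key i y)%N) (y \in above l).
Proof. by rewrite inE; apply: forall_inP. Qed.

Lemma above_le l y d : y \in above l -> d \in E -> (key l y <= key l d)%N.
Proof.
move=> /aboveP y_above dE; have [i y_le] := dominantP _ domE y.
have [<-|il] := eqVneq i l; first exact: y_le.
by have := y_above i il; rewrite ltnNge y_le //; case: (mn_low i).
Qed.

Lemma mem_lowest_neq d : d \in E -> exists2 i, i != j & d = mn i.
Proof.
rewrite -(lowest_onto domE mn_low) => /imsetP[i _ ->].
by have [->|ij] := eqVneq i j; [exists k; rewrite // eq_sym | exists i].
Qed.

Lemma highest_above_extension x :
  x \in above j -> (forall y, y \in above j -> (key j y <= key j x)%N) ->
  x \in extensions E.
Proof.
move=> x_above x_max; have /aboveP x_gt := x_above.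
rewrite inE; apply/andP; split.
  by apply/negP => /mem_lowest_neq[i ij xE]; have := x_gt i ij; rewrite xE ltnn.
apply/dominantP => y; have [y_above|] := boolP (y \in above j).
  exists j => d; rewrite !inE => /predU1P[->|]; first exact: x_max.
  exact: above_le.
rewrite inE => /forall_inPn[i ij]; rewrite -leqNgt => y_le.
exists i => d; rewrite !inE => /predU1P[->|dE].
  exact: leq_trans y_le (ltnW (x_gt i ij)).
by apply: leq_trans y_le _; case: (mn_low i) => _; apply.
Qed.

Lemma extension_highest_above x :
  x \in extensions E -> forall y, y \in above j -> (key j y <= key j x)%N.
Proof.
rewrite inE => /andP[xE /dominantP dom_x] y /aboveP y_gt.
have [i y_le] := dom_x y; have [<-|ij] := eqVneq i j.
  by apply: y_le; rewrite setU11.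
by have := y_gt i ij; rewrite ltnNge y_le // setU1r //; case: (mn_low i).
Qed.

Lemma above_disjoint : [disjoint above j & above k].
Proof.
apply/pred0P => y /=; apply/negP => /andP[/aboveP y_j /aboveP y_k].
have [i y_le] := dominantP _ domE y; have [mniE _] := mn_low i.
have [ij|ij] := eqVneq i j; last by have := y_j i ij; rewrite ltnNge y_le.
by have := y_k i; rewrite ltnNge y_le // ij neq_jk => /(_ isT).
Qed.

(* A dominant set of size #|I| assigns distinct elements to the indices at which
   they are lowest, so x is lowest at exactly one index l, and mn is injective
   away from l. *)
Lemma extension_above x :
  x \in extensions E -> (x \in above j) || (x \in above k).
Proof.
rewrite inE => /andP[xE dom_x].
have [|mnx mnx_low] := @exists_lowest (x |: E).
  by apply/set0Pn; exists x; rewrite setU11.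
have mnx_onto := lowest_onto dom_x mnx_low.
have /imset_injP mnx_inj : #|mnx @: [set: I]| == #|[set: I]|.
  by rewrite mnx_onto cardsU1 xE cardsT -cardE.
have [l _ xl] : exists2 l, l \in [set: I] & x = mnx l.
  by apply/imsetP; rewrite mnx_onto setU11.
have mnx_mn i : i != l -> mnx i = mn i.
  move=> il; apply: lowest_unique (mn_low i).
  apply: (lowestS (subsetUr _ _) _ (mnx_low i)).
  have [] := mnx_low i; rewrite !inE => /predU1P[xi|//] _.
  by rewrite (mnx_inj i l) ?eqxx ?in_setT // in il; rewrite xi.
have x_above : x \in above l.
  apply/aboveP => i il; rewrite -mnx_mn //.
  have [_ /(_ x (setU11 _ _))] := mnx_low i.
  rewrite leq_eqVlt => /predU1P[/key_inj xi|//].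
  by case: (mn_low i) => mniE _; rewrite -xi mnx_mn ?mniE in xE.
have [->|jl] := eqVneq j l; first by rewrite x_above.
have [->|kl] := eqVneq k l; first by rewrite x_above orbT.
by have := neq_jk; rewrite (mnx_inj j k) ?in_setT ?mnx_mn ?eqxx.
Qed.

End Extensions.

Lemma card_max_above (i : I) (M N : {set T}) :
  (forall x, x \in M -> (forall y, y \in M -> (key i y <= key i x)%N) ->
    x \in N) ->
  (forall x, x \in N -> forall y, y \in M -> (key i y <= key i x)%N) ->
  #|M :&: N| = (M != set0).
Proof.
move=> maxN Nmax; have [->|[x0 x0M]] := set_0Vmem M.
  by rewrite set0I cards0 eqxx.
have -> : M != set0 by apply/set0Pn; exists x0.
case: (arg_maxnP (key i) x0M) => x xM x_max.
rewrite (_ : M :&: N = [set x]) ?cards1 //; apply/setP => y; rewrite !inE.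
apply/andP/eqP => [[yM yN]|->]; last by split=> //; apply: maxN.
apply: (@key_inj i); apply/eqP; rewrite eqn_leq (Nmax y) // andbT.
exact: x_max.
Qed.

Lemma card_extensions E mn j k :
  dominant E -> #|E|.+1 = #|I| -> (forall i, lowest E i (mn i)) ->
  j != k -> mn j = mn k ->
  #|extensions E| = ((above mn j != set0) + (above mn k != set0))%N.
Proof.
move=> domE cardE mn_low jk mn_jk; have kj : k != j by rewrite eq_sym.
have max_above l m (lm : l != m) (mn_lm : mn l = mn m) :=
  card_max_above (highest_above_extension domE mn_low lm mn_lm)
                 (extension_highest_above mn_low).
rewrite -(max_above j k) // -(max_above k j) // -cardsUI setIACA.
have /disjoint_setI0-> := above_disjoint domE mn_low jk.
rewrite set0I cards0 addn0 -setIUl (setIidPr _) //; apply/subsetP => x.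
by rewrite in_setU; apply: (extension_above cardE mn_low jk mn_jk).
Qed.

Lemma lowest_collision E mn :
  dominant E -> #|E|.+1 = #|I| -> (forall i, lowest E i (mn i)) ->
  exists j k, j != k /\ mn j = mn k.
Proof.
move=> domE cardE mn_low; have : ~~ injectiveb mn.
  apply/negP => /injectiveP mn_inj; have := card_imset [set: I] mn_inj.
  by rewrite (lowest_onto domE mn_low) cardsT; lia.
by case/injectivePn => j [k jk mn_jk]; exists j, k.
Qed.

(** * The boundary of the dominant sets *)

Section Slack.
Variables (slack : I -> T) (x0 : T).
Hypothesis slack_lowest : forall i t, (key i (slack i) <= key i t)%N.
Hypothesis slack_highest : forall i j x,
  j != i -> x \notin codom slack -> (key i x < key i (slack j))%N.
Hypothesis x0_slack : x0 \notin codom slack.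

Definition slacks := slack @: [set: I].

Lemma mem_slacks x : (x \in slacks) = (x \in codom slack).
Proof. by apply/imsetP/codomP => [[i _ ->]|[i ->]]; exists i. Qed.

Lemma slack_inj : injective slack.
Proof.
move=> i j eq_ij; apply/eqP; apply: contraTT (slack_lowest i x0) => ij.
by rewrite -ltnNge eq_ij slack_highest // eq_sym.
Qed.

Lemma card_slacks : #|slacks| = #|I|.
Proof. by rewrite card_imset ?cardsT //; apply: slack_inj. Qed.

Lemma slacks_not_dominant : ~~ dominant slacks.
Proof.
apply/negP => /dominantP/(_ x0)[i]/(_ (slack i) (imset_f _ (in_setT i))).
rewrite leqNgt ltn_neqAle slack_lowest andbT negbK => /eqP/key_inj x0E.
by have := x0_slack; rewrite -x0E codom_f.
Qed.

Lemma slackD1_dominant i : dominant (slacks :\ slack i).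
Proof.
apply/dominantP => y; have [/codomP[l ->]|y_slack] := boolP (y \in codom slack).
  by exists l => d _; apply: slack_lowest.
exists i => d; rewrite !inE mem_slacks => /andP[di /codomP[l dl]].
rewrite dl; apply/ltnW/slack_highest => //.
by apply: contraNneq di => <-; rewrite dl.
Qed.

Lemma above_slack E mn e l :
  (forall i, lowest E i (mn i)) -> e \in E -> e \notin codom slack ->
  slack l \in above mn l.
Proof.
move=> mn_low eE e_slack; apply/aboveP => i il; have [_ mn_le] := mn_low i.
by apply: leq_ltn_trans (mn_le e eE) _; rewrite slack_highest // eq_sym.
Qed.

Section SlackFacet.
Variables (l : I) (mn : I -> T).
Hypothesis mn_low : forall i, lowest (slacks :\ slack l) i (mn i).

Lemma lowest_slackD1 i : i != l -> mn i = slack i.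
Proof.
move=> il; apply: lowest_unique (mn_low i) _.
split=> [|d _]; last exact: slack_lowest.
by rewrite !inE mem_slacks codom_f (inj_eq slack_inj) il.
Qed.

Lemma nonslack_above : x0 \in above mn l.
Proof.
apply/aboveP => i il; rewrite lowest_slackD1 // ltn_neqAle slack_lowest andbT.
by apply: contraNneq x0_slack => /key_inj <-; apply: codom_f.
Qed.

Lemma above_slackD1_eq0 k : k != l -> mn l = mn k -> above mn k = set0.
Proof.
move=> kl mn_lk; apply/setP => y; rewrite in_set0; apply/negP => /aboveP y_gt.
have := y_gt l; rewrite eq_sym kl mn_lk lowest_slackD1 // => /(_ isT) slack_lt.
have [/codomP[i yi]|y_slack] := boolP (y \in codom slack); last first.
  by have := slack_highest kl y_slack; rewrite ltnNge (ltnW slack_lt).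
have [il|il] := eqVneq i l.
  by move: slack_lt; rewrite yi il ltnNge slack_lowest.
have [ik|ik] := eqVneq i k; first by move: slack_lt; rewrite yi ik ltnn.
by have := y_gt i ik; rewrite lowest_slackD1 // yi ltnn.
Qed.

Lemma odd_above_slackD1 k : k != l -> mn l = mn k ->
  odd ((above mn l != set0) + (above mn k != set0)).
Proof.
move=> kl mn_lk; rewrite (above_slackD1_eq0 kl) // eqxx addn0 oddb.
by apply/set0Pn; exists x0; apply: nonslack_above.
Qed.

End SlackFacet.

Lemma slackD1P E :
  E \subset slacks -> #|E|.+1 = #|I| -> exists l, E = slacks :\ slack l.
Proof.
move=> sE cardE.
have : E \proper slacks by rewrite properEcard sE card_slacks -cardE ltnSn.
case/properP => _ [_ /imsetP[l _ ->] lE]; exists l; apply/eqP.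
rewrite eqEcard subsetD1 sE lE /=; have := cardsD1 (slack l) slacks.
by rewrite imset_f ?in_setT // card_slacks; lia.
Qed.

Lemma odd_extensions_set0 : #|I| = 1%N -> odd #|extensions set0|.
Proof.
case/fintype1 => i all_i; rewrite -[extensions set0]setTI.
rewrite (@card_max_above i) => [|x _ x_max|x].
- by have /set0Pn-> : exists x, x \in [set: T] by exists x0.
- rewrite !inE setU0; apply/dominantP => y; exists i => d.
  by rewrite inE => /eqP->; apply: x_max.
- rewrite inE setU0 => /andP[_ /dominantP x_dom] y _; have [l] := x_dom y.
  by rewrite (all_i l); apply; rewrite inE.
Qed.

Lemma odd_extensions E :
  dominant E -> #|E|.+1 = #|I| -> odd #|extensions E| = (E \subset slacks).
Proof.
move=> domE cardE; have [E0|E_neq0] := eqVneq E set0.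
  by rewrite E0 sub0set odd_extensions_set0 // -cardE E0 cards0.
have [mn mn_low] := exists_lowest E_neq0.
have [j [k [jk mn_jk]]] := lowest_collision domE cardE mn_low.
rewrite (card_extensions domE cardE mn_low jk mn_jk).
have [sE|] := boolP (E \subset slacks); last first.
  case/subsetPn => e eE; rewrite mem_slacks => e_slack.
  have above_neq0 i : above mn i != set0.
    by apply/set0Pn; exists (slack i); apply: above_slack eE e_slack.
  by rewrite !above_neq0.
have [l defE] := slackD1P sE cardE; rewrite {}defE in mn_low.
have [jl|jl] := eqVneq j l.
  by rewrite jl in jk mn_jk *; apply: odd_above_slackD1; rewrite // eq_sym.
have [kl|kl] := eqVneq k l.
  by rewrite kl addnC in jk mn_jk *; apply: odd_above_slackD1.
have /slack_inj eq_jk : slack j = slack k by rewrite -!(lowest_slackD1 mn_low).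
by rewrite eq_jk eqxx in jk.
Qed.

Definition dominant_cycle :=
  [set P : {set T} | (#|P| == #|I|) && (dominant P || (P == slacks))].

Lemma cofaces_dominant_cycle E : dominant E -> #|E|.+1 = #|I| ->
  cofaces dominant_cycle E =
  extensions E :|: cofaces [set slacks] E.
Proof.
move=> domE cardE; apply/setP => x; rewrite !inE.
by case: (boolP (x \in E)) => //= xE; rewrite cardsU1 xE add1n cardE eqxx.
Qed.

Lemma card_cofaces_slacks E : #|E|.+1 = #|I| ->
  #|cofaces [set slacks] E| = (E \subset slacks).
Proof.
move=> cardE; have [sE|nsE] := boolP (E \subset slacks); last first.
  rewrite (_ : cofaces _ E = set0) ?cards0 //; apply/setP => x; rewrite !inE.
  by apply/negbTE; apply: contraNN nsE => /andP[_ /eqP<-]; apply: subsetUr.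
have [l ->] := slackD1P sE cardE.
rewrite (_ : cofaces _ _ = [set slack l]) ?cards1 //; apply/setP => x.
rewrite !inE; have l_slack : slack l \in slacks by rewrite mem_slacks codom_f.
have [->|xl] := eqVneq x (slack l); first by rewrite setD1K // eqxx.
apply/negbTE/negP => /andP[x_slack /eqP slackE].
by move: l_slack; rewrite -slackE !inE eqxx orbF eq_sym (negbTE xl).
Qed.

Lemma mod2_cycle_dominant : mod2_cycle dominant_cycle.
Proof.
move=> E; have [cofaces0|[x]] := set_0Vmem (cofaces dominant_cycle E).
  by rewrite cofaces0 cards0.
rewrite !inE => /and3P[xE]; rewrite cardsU1 xE add1n => /eqP cardE domE.
have {}domE : dominant E.
  case/orP: domE => [|/eqP slackE]; first by apply: dominantS; apply: subsetUr.
  have /slackD1P[|l ->] // : E \subset slacks by rewrite -slackE subsetUr.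
  exact: slackD1_dominant.
rewrite cofaces_dominant_cycle //.
have disjoint_cofaces : [disjoint extensions E & cofaces [set slacks] E].
  apply/pred0P => y; rewrite !inE; apply/negP => /andP[/andP[_ dom_y]].
  move=> /andP[_ /eqP slackE].
  by rewrite slackE (negbTE slacks_not_dominant) in dom_y.
rewrite cardsU disjoint_setI0 // cards0 subn0 oddD odd_extensions //.
by rewrite card_cofaces_slacks // oddb addbb.
Qed.

Lemma exists_dominant_cocycle (B : {set {set T}}) :
  mod2_cocycle B -> slacks \in B ->
  exists2 P, P \in B & dominant P.
Proof.
move=> cocB slackB; have := even_cycleI_cocycle x0 mod2_cycle_dominant cocB.
rewrite (cardsD1 slacks) !inE slackB eqxx orbT andbT card_slacks eqxx /= negbK.
have [->|[P]] := set_0Vmem (dominant_cycle :&: B :\ slacks).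
  by rewrite cards0.
rewrite !inE => /andP[/negbTE P_slack /andP[/andP[_]]]; rewrite P_slack orbF.
by exists P.
Qed.

End Slack.
End Dominance.

(** * Feasible bases *)

Lemma exists_relation (R : fieldType) (J K : finType)
    (S : {set J}) (U : {set K}) (a : K -> J -> R) : (#|U| < #|S|)%N ->
  exists z : J -> R, [/\ exists j, z j != 0, forall j, j \notin S -> z j = 0
    & forall k, k \in U -> \sum_j a k j * z j = 0].
Proof.
move=> ltUS; pose M := \matrix_(i < #|S|, l < #|U|) a (enum_val l) (enum_val i).
have /rowV0Pn[u /sub_kermxP uM] : kermx M != 0.
  by rewrite kermx_eq0 -row_leq_rank -ltnNge (leq_ltn_trans (rank_leq_col M)).
case/rV0Pn => i0 ui0.
exists (fun j => \sum_(i < #|S|) u 0 i * (enum_val i == j)%:R); split.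
- exists (enum_val i0); rewrite (bigD1 i0) //= eqxx mulr1.
  rewrite big1 ?addr0 // => i ii0.
  by rewrite (inj_eq enum_val_inj) (negbTE ii0) mulr0.
- move=> j jS; rewrite big1 // => i _; case: eqP => [ij|_]; last exact: mulr0.
  by rewrite -ij enum_valP in jS.
- move=> k kU; have := congr1 (fun v : 'rV_ _ => v 0 (enum_rank_in kU k)) uM.
  rewrite mxE [RHS]mxE; apply: etrans; under eq_bigr do rewrite mulr_sumr.
  rewrite exchange_big; apply: eq_bigr => i _; rewrite mxE enum_rankK_in //.
  rewrite (bigD1 (enum_val i)) //= eqxx mulr1 mulrC big1 ?addr0 // => j ij.
  by rewrite eq_sym (negbTE ij) !mulr0.
Qed.

Lemma ratio_test (R : realFieldType) (T : finType) (x z : T -> R) :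
  (forall t, 0 <= x t) -> (exists t, z t < 0) ->
  exists s t, [/\ 0 <= s, z t < 0, x t + s * z t = 0
    & forall u, 0 <= x u + s * z u].
Proof.
move=> x_ge0 [t0 zt0]; pose ratio t := x t / - z t.
case: (arg_minP (P := [pred t | z t < 0]) ratio zt0) => t /= zt t_min.
exists (ratio t), t; split=> //.
- by rewrite divr_ge0 // oppr_ge0 ltW.
- by rewrite /ratio; field; rewrite lt_eqF.
move=> u; have [zu|zu] := ltP (z u) 0; last first.
  by rewrite addr_ge0 // mulr_ge0 // divr_ge0 // oppr_ge0 ltW.
have := t_min u zu; rewrite [ratio u]/ratio ler_pdivlMr ?oppr_gt0 //.
by rewrite mulrN -subr_ge0 opprK.
Qed.

Section Feasible.
Variables (R : realFieldType) (I T : finType) (a : I -> T -> R) (b : I -> R).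
Implicit Types (P : {set T}) (x y z : T -> R).

Definition lhs (x : T -> R) i := \sum_t a i t * x t.

Lemma lhsD x y : lhs (fun t => x t + y t) =1 (fun i => lhs x i + lhs y i).
Proof.
by move=> i; rewrite /lhs -big_split; apply: eq_bigr => t _; rewrite mulrDr.
Qed.

Lemma lhsZ s x : lhs (fun t => s * x t) =1 (fun i => s * lhs x i).
Proof.
by move=> i; rewrite /lhs mulr_sumr; apply: eq_bigr => t _; rewrite mulrCA.
Qed.

Definition kernel (z : T -> R) := forall i, lhs z i = 0.

Definition support (x : T -> R) := [set t | x t != 0].

Lemma support_sub (P : {set T}) (x : T -> R) :
  (forall t, t \notin P -> x t = 0) -> support x \subset P.
Proof.
by move=> x_out; apply/subsetP => t; rewrite inE; apply: contraNT => /x_out->.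
Qed.

Definition generic_rhs := forall x, lhs x =1 b -> (#|I| <= #|support x|)%N.

Definition solution_on (P : {set T}) (x : T -> R) :=
  [/\ forall t, 0 <= x t, forall t, t \notin P -> x t = 0 & lhs x =1 b].

Definition feasible_bases :=
  [set P : {set T} | (#|P| == #|I|) && `[< exists x, solution_on P x >]].

Lemma feasible_basesP P :
  reflect (#|P| = #|I| /\ exists x, solution_on P x) (P \in feasible_bases).
Proof.
rewrite inE; apply: (iffP andP) => -[]; first by move=> /eqP ? /asboolP.
by move=> /eqP ? ?; split=> //; apply/asboolP.
Qed.

Hypothesis b_generic : generic_rhs.
Hypothesis a_ge0 : forall i t, 0 <= a i t.
Hypothesis a_col : forall t, exists i, 0 < a i t.

Lemma solution_gt0 P x t : solution_on P x -> #|P| = #|I| -> t \in P -> 0 < x t.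
Proof.
move=> [x_ge0 x_out xb] cardP; have <- : support x = P.
  by apply/eqP; rewrite eqEcard support_sub // cardP b_generic.
by rewrite inE lt_neqAle eq_sym x_ge0 andbT.
Qed.

Lemma kernel_has_neg z t : kernel z -> z t != 0 -> exists u, z u < 0.
Proof.
move=> z_ker zt; apply/existsP; apply: contraNT zt => /existsPn z_ge0.
have {}z_ge0 u : 0 <= z u by rewrite leNgt z_ge0.
have [i ait] := a_col t; have /eqP := z_ker i.
rewrite psumr_eq0 => [/allP/(_ t (mem_index_enum t))|u _]; last exact: mulr_ge0.
by rewrite mulf_eq0 gt_eqF.
Qed.

Lemma solution_slide P x z :
  solution_on P x -> kernel z -> (forall t, t \notin P -> 0 <= z t) ->
  (exists t, z t < 0) ->
  exists s t, t \in P /\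
    solution_on ((P :|: support z) :\ t) (fun u => x u + s * z u).
Proof.
move=> [x_ge0 x_out xb] z_ker z_out z_neg.
have [s [t [s_ge0 zt yt y_ge0]]] := ratio_test x_ge0 z_neg.
exists s, t; split; first by apply: contraTT zt => /z_out; rewrite leNgt.
split=> // [u|i]; last by rewrite lhsD lhsZ z_ker mulr0 addr0 xb.
rewrite !inE negb_and negbK negb_or negbK.
by move=> /predU1P[-> //|/andP[/x_out-> /eqP->]]; rewrite mulr0 addr0.
Qed.

Section Pivot.
Variable Q : {set T}.
Hypothesis cardQ : #|Q| = #|I|.+1.

Lemma card_facet t : t \in Q -> #|Q :\ t| = #|I|.
Proof. by move=> tQ; have := cardsD1 t Q; rewrite tQ cardQ => -[]. Qed.

Lemma kernel_facet t x z : t \in Q -> solution_on (Q :\ t) x ->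
  kernel z -> (forall u, u \notin Q :\ t -> z u = 0) -> z =1 (fun=> 0).
Proof.
move=> tQ sol_x z_ker z_out u; apply/eqP/negPn/negP => zu.
have z_neg := kernel_has_neg z_ker zu.
have [|s [v [vQ [_ y_out yb]]]] := solution_slide sol_x z_ker _ z_neg.
  by move=> w /z_out->.
have := leq_trans (b_generic yb) (subset_leq_card (support_sub y_out)).
rewrite (setUidPl (support_sub z_out)).
by have := cardsD1 v (Q :\ t); rewrite vQ card_facet //; lia.
Qed.

Lemma pivot_direction t x : t \in Q -> solution_on (Q :\ t) x ->
  exists z, [/\ kernel z, forall u, u \notin Q -> z u = 0 & z t = 1].
Proof.
move=> tQ sol_x.
have [|z [[v zv] z_out z_ker]] := @exists_relation _ _ _ Q [set: I] a.
  by rewrite cardsT cardQ.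
have {}z_ker : kernel z by move=> i; apply: z_ker; rewrite in_setT.
have zt : z t != 0.
  apply: contraNneq zv => zt; apply/eqP/(kernel_facet tQ sol_x z_ker) => w.
  by rewrite !inE negb_and negbK => /predU1P[->|/z_out].
exists (fun u => (z t)^-1 * z u); split; last by rewrite mulVf.
- by move=> i; rewrite lhsZ z_ker mulr0.
- by move=> u /z_out->; rewrite mulr0.
Qed.

Lemma pivot_exists t : t \in Q -> Q :\ t \in feasible_bases ->
  exists2 u, u \in Q :\ t & Q :\ u \in feasible_bases.
Proof.
move=> tQ /feasible_basesP[_ [x sol_x]].
have [z [z_ker z_out zt]] := pivot_direction tQ sol_x.
have zt_neq0 : z t != 0 by rewrite zt oner_neq0.
have z_neg := kernel_has_neg z_ker zt_neq0.
have [|s [u [uQ sol_y]]] := solution_slide sol_x z_ker _ z_neg.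
  move=> u; rewrite !inE negb_and negbK.
  by move=> /predU1P[->|/z_out->]; rewrite ?zt.
exists u => //; have [ut uQ'] := setD1P uQ.
apply/feasible_basesP; split; first exact: card_facet.
suff <- : Q :\ t :|: support z = Q by exists (fun v => x v + s * z v).
apply/eqP; rewrite eqEsubset subUset subsetDl support_sub //=.
apply/subsetP => v vQ; rewrite !inE vQ andbT.
by case: eqVneq => // ->.
Qed.

Lemma facet_solution_gt0 t u x :
  solution_on (Q :\ t) x -> t \in Q -> u \in Q -> u != t -> 0 < x u.
Proof.
move=> sol_x tQ uQ ut.
by apply: solution_gt0 sol_x (card_facet tQ) _; apply/setD1P.
Qed.

Lemma facet_solution_eq0 t x : solution_on (Q :\ t) x -> x t = 0.
Proof. by case=> _ x_out _; apply: x_out; rewrite setD11. Qed.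

(* The solutions supported on Q lie on a line, which leaves the orthant at two
   points. *)
Lemma pivot_unique t u v x y w : t \in Q -> u \in Q -> v \in Q ->
  solution_on (Q :\ t) x -> solution_on (Q :\ u) y -> solution_on (Q :\ v) w ->
  u != t -> v != t -> u = v.
Proof.
move=> tQ uQ vQ sol_x sol_y sol_w ut vt; apply/eqP/negPn/negP => uv.
have yt_gt0 : 0 < y t by rewrite (facet_solution_gt0 sol_y) // eq_sym.
have wt_gt0 : 0 < w t by rewrite (facet_solution_gt0 sol_w) // eq_sym.
pose r := y t / w t.
pose z q := y q + (- r * w q + (r - 1) * x q).
have z_eq0 : z =1 (fun=> 0).
  apply: (kernel_facet tQ sol_x) => [i|q].
    have [[_ _ xb] [_ _ yb] [_ _ wb]] := And3 sol_x sol_y sol_w.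
    by rewrite !lhsD !lhsZ xb yb wb; ring.
  rewrite !inE negb_and negbK => /predU1P[->|qQ]; last first.
    have [[_ x_out _] [_ y_out _] [_ w_out _]] := And3 sol_x sol_y sol_w.
    by rewrite /z x_out ?y_out ?w_out ?inE ?(negbTE qQ) ?andbF // !mulr0 !addr0.
  by rewrite /z (facet_solution_eq0 sol_x) /r; field; rewrite gt_eqF.
have r_gt1 : 0 < r - 1.
  rewrite -(pmulr_lgt0 _ (facet_solution_gt0 sol_x tQ uQ ut)).
  have -> : (r - 1) * x u = r * w u.
    by have := z_eq0 u; rewrite /z (facet_solution_eq0 sol_y); lra.
  by rewrite mulr_gt0 ?divr_gt0 // (facet_solution_gt0 sol_w).
have := mulr_gt0 r_gt1 (facet_solution_gt0 sol_x tQ vQ vt).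
have := facet_solution_gt0 sol_y uQ vQ; rewrite eq_sym uv => /(_ isT).
by have := z_eq0 v; rewrite /z (facet_solution_eq0 sol_w); lra.
Qed.

End Pivot.

Lemma mod2_cocycle_feasible_bases : mod2_cocycle feasible_bases.
Proof.
move=> Q; have [->|[t]] := set_0Vmem (facets feasible_bases Q).
  by rewrite cards0.
rewrite inE => /andP[tQ t_basis].
have cardQ : #|Q| = #|I|.+1.
  by have [<- _] := feasible_basesP _ t_basis; rewrite (cardsD1 t Q) tQ.
have [u /setD1P[ut uQ] u_basis] := pivot_exists cardQ tQ t_basis.
suff -> : facets feasible_bases Q = [set t; u] by rewrite cards2 eq_sym ut.
apply/setP => v; rewrite [LHS]inE in_set2.
apply/andP/orP => [[vQ v_basis]|]; last first.
  by case=> /eqP->; split.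
have [|vt] := eqVneq v t; [by left | right]; apply/eqP.
have [_ [x sol_x]] := feasible_basesP _ t_basis.
have [_ [y sol_y]] := feasible_basesP _ u_basis.
have [_ [w sol_w]] := feasible_basesP _ v_basis.
exact: (pivot_unique cardQ tQ vQ uQ sol_x sol_w sol_y).
Qed.

End Feasible.

(** * Generic right-hand sides *)

Lemma exists_nonroot (R : realFieldType) (p : {poly R}) :
  p != 0 -> exists s, [/\ 0 < s, s <= 1 & ~~ root p s].
Proof.
move=> p_neq0; pose invs := [seq n.+1%:R^-1 : R | n <- iota 0 (size p)].
have invs_uniq : uniq invs.
  rewrite map_inj_uniq ?iota_uniq // => m n /invr_inj/eqP.
  by rewrite eqr_nat => /eqP[].
have /allPn[s] : ~~ all (root p) invs.
  apply: contraL (leqnn (size p)) => invs_roots; rewrite -ltnNge.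
  have := max_poly_roots p_neq0 invs_roots invs_uniq.
  by rewrite size_map size_iota ltnn.
case/mapP => n _ -> s_nonroot; exists n.+1%:R^-1.
by rewrite invr_gt0 invf_le1 ?ltr0n ?ler1n.
Qed.

Section Generic.
Variables (R : realFieldType) (I T : finType) (a : I -> T -> R).
Variables (b0 : I -> R) (delta : R).
Hypothesis delta_gt0 : 0 < delta.

Definition moment_curve (s : R) i := b0 i + delta * s ^+ (enum_rank i).+1.

Lemma moment_curve_poly (u : I -> R) : (exists i, u i != 0) ->
  exists2 p : {poly R}, p != 0 &
    forall s, p.[s] = \sum_i u i * moment_curve s i.
Proof.
case=> i0 ui0; pose e (i : I) : nat := (enum_rank i).+1.
exists (\sum_i u i *: ((b0 i)%:P + delta *: 'X^(e i))) => [|s]; last first.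
  by rewrite horner_sum; apply: eq_bigr => i _; rewrite !hornerE.
apply: contraNneq ui0 => /(congr1 (coefp (e i0))).
rewrite /coefp coef_sum coef0 (bigD1 i0) //= big1 ?addr0 => [|i ii0].
  rewrite coefZ coefD coefC coefZ coefXn eqxx add0r mulr1 => /eqP.
  by rewrite mulf_eq0 (gt_eqF delta_gt0) orbF.
rewrite coefZ coefD coefC coefZ coefXn /= eqSS add0r.
by rewrite (inj_eq (inj_comp val_inj enum_rank_inj)) eq_sym (negbTE ii0) !mulr0.
Qed.

Lemma moment_curve_small_support (S : {set T}) : (#|S| < #|I|)%N ->
  exists2 p : {poly R}, p != 0 &
    forall s x, support x \subset S -> lhs a x =1 moment_curve s -> root p s.
Proof.
move=> ltS; have [|u [u_neq0 _ u_orth]] :=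
    @exists_relation _ _ _ [set: I] S (fun t i => a i t).
  by rewrite cardsT.
have [p p_neq0 p_eval] := moment_curve_poly u_neq0.
exists p => // s x /subsetP xS xb; apply/eqP; rewrite p_eval.
under eq_bigr => i _ do rewrite -xb /lhs mulr_sumr.
rewrite exchange_big big1 // => t _; have [tS|tS] := boolP (t \in S).
  under eq_bigr do rewrite mulrA [u _ * _]mulrC.
  by rewrite -mulr_suml u_orth ?mul0r.
have /eqP-> : x t == 0 by apply: contraNT tS => xt; apply: xS; rewrite inE.
by rewrite big1 // => i _; rewrite !mulr0.
Qed.

(* A moment curve meets each proper subspace in finitely many points. *)
Lemma exists_generic_rhs :
  exists2 b, generic_rhs a b & forall i, b0 i < b i <= b0 i + delta.
Proof.
have /choice[p p_root] (S : {set T}) : exists p : {poly R}, p != 0 /\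
    forall s x, (#|S| < #|I|)%N -> support x \subset S ->
      lhs a x =1 moment_curve s -> root p s.
  have [leS|/moment_curve_small_support[p p_neq0 p_root]] := leqP #|I| #|S|.
    by exists 1; rewrite oner_neq0.
  by exists p; split=> // s x _; apply: p_root.
have [|s [s_gt0 s_le1 s_nonroot]] := @exists_nonroot _ (\prod_S p S).
  by apply/prodf_neq0 => S _; case: (p_root S).
exists (moment_curve s) => [x xb|i]; last first.
  by rewrite ltrDl lerD2l mulr_gt0 ?exprn_gt0 //= ger_pMr // exprn_ile1 // ltW.
rewrite leqNgt; apply: contra s_nonroot => supp_lt.
have [_ /(_ s x supp_lt (subxx _) xb) root_s] := p_root (support x).
by rewrite (bigD1 (support x)) //= rootM root_s.
Qed.

End Generic.

(** * Scarf's lemma *)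

Section TieBreak.
Variables (T : finType) (f : T -> nat).

Definition tie_break x := (f x * #|T| + enum_rank x)%N.

Lemma ltn_tie_break x y : (f x < f y)%N -> (tie_break x < tie_break y)%N.
Proof.
move=> lt_xy; have rank_lt := ltn_ord (enum_rank x).
apply: leq_trans (_ : (f x).+1 * #|T| <= _)%N; last first.
  by apply: leq_trans (leq_addr _ _); rewrite leq_mul2r lt_xy orbT.
by rewrite /tie_break mulSn addnC ltn_add2r.
Qed.

Lemma leq_tie_break x y : (tie_break x <= tie_break y)%N -> (f x <= f y)%N.
Proof. by apply: contraTT; rewrite -!ltnNge; apply: ltn_tie_break. Qed.

Lemma tie_break_inj : injective tie_break.
Proof.
move=> x y eq_xy; apply/enum_rank_inj/ord_inj.
have /eqP := congr1 (modn^~ #|T|) eq_xy.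
by rewrite !modnMDl !modn_small // => /eqP.
Qed.

End TieBreak.

Section Scarf.
Variables (R : realFieldType) (I X : finType).
Variables (a : I -> X -> R) (rank : I -> X -> nat).
Hypothesis a_ge0 : forall i x, 0 <= a i x.
Hypothesis a_col : forall x, exists i, 0 < a i x.

Definition slack_matrix i (t : X + I) : R :=
  match t with inl x => a i x | inr j => (i == j)%:R end.

Let top := (\max_(p : I * X) rank p.1 p.2).+1%N.

(* A column that avoids row i outranks all columns meeting it, so it can be
   dominated at row i only if no column in use meets row i, which b i > 0
   excludes. *)
Definition slack_rank i (t : X + I) : nat :=
  match t with
  | inl x => if a i x == 0 then top.+1 else (rank i x).+1
  | inr j => if j == i then 0 else top.+2
  end.

Lemma slack_matrix_ge0 i t : 0 <= slack_matrix i t.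
Proof. by case: t => [x|j] /=; rewrite ?ler0n. Qed.

Lemma slack_matrix_col t : exists i, 0 < slack_matrix i t.
Proof.
by case: t => [x|j] /=; [apply: a_col | exists j; rewrite eqxx ltr01].
Qed.

Lemma lhs_slack_matrix z i :
  lhs slack_matrix z i = lhs a (z \o inl) i + z (inr i).
Proof.
rewrite /lhs big_sumType /=; congr (_ + _).
rewrite (bigD1 i) //= eqxx mul1r big1 ?addr0 // => j ji.
by rewrite eq_sym (negbTE ji) mul0r.
Qed.

Lemma slack_rank_gt0 i t : t != inr i -> (0 < slack_rank i t)%N.
Proof.
case: t => [x|j] /=; first by case: ifP.
by case: (eqVneq j i) => // ->; rewrite eqxx.
Qed.

Lemma rank_lt_top i x : (rank i x < top)%N.
Proof. by rewrite ltnS (leq_bigmax (i, x)). Qed.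

Lemma slack_rank_lt_top i x : (slack_rank i (inl x) < top.+2)%N.
Proof. by rewrite /=; case: ifP => // _; rewrite ltnS leqW // rank_lt_top. Qed.

Section GenericRhs.
Variables (b : I -> R) (x0 : X).
Hypothesis b_generic : generic_rhs slack_matrix b.
Hypothesis b_gt0 : forall i, 0 < b i.

Lemma slacks_feasible : slacks inr \in feasible_bases slack_matrix b.
Proof.
apply/feasible_basesP; split.
  by rewrite card_imset ?cardsT //; apply: inr_inj.
exists (fun t => if t is inr i then b i else 0); split=> [[x|i]|[x|i]|i] //.
- exact: ltW.
- by rewrite mem_slacks codom_f.
- by rewrite lhs_slack_matrix /= /lhs big1 ?add0r // => x _; rewrite mulr0.
Qed.

Lemma exists_dominant_solution : exists P z, solution_on slack_matrix b P z /\
  forall t, exists i, forall d, d \in P -> (slack_rank i t <= slack_rank i d)%N.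
Proof.
pose key i := tie_break (slack_rank i).
have key_inj i : injective (key i) by apply: tie_break_inj.
have lowest_slack i t : (key i (inr i) <= key i t)%N.
  have [->|/slack_rank_gt0 t_gt0] := eqVneq t (inr i); first by [].
  by apply/ltnW/ltn_tie_break; rewrite /= eqxx.
have highest_slack i j t :
    j != i -> t \notin codom inr -> (key i t < key i (inr j))%N.
  move=> ji; case: t => [x _|l]; last by rewrite codom_f.
  apply: ltn_tie_break; rewrite [slack_rank i (inr j)]/= (negbTE ji).
  exact: slack_rank_lt_top.
have x0_slack : inl x0 \notin codom (@inr X I) by apply/codomP => -[].
have cocycle_bases :=
  mod2_cocycle_feasible_bases b_generic slack_matrix_ge0 slack_matrix_col.
have [P P_basis /dominantP domP] := exists_dominant_cocycle key_inj
  lowest_slack highest_slack x0_slack cocycle_bases slacks_feasible.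
have /feasible_basesP[_ [z sol_z]] := P_basis.
exists P, z; split=> // t; have [i t_le] := domP t; exists i => d /t_le.
exact: leq_tie_break.
Qed.

Lemma scarf_generic : exists y, [/\ forall x, 0 <= y x,
    forall i, lhs a y i <= b i
  & forall x, exists i, [/\ 0 < a i x, lhs a y i = b i
    & forall x', 0 < y x' -> 0 < a i x' -> (rank i x <= rank i x')%N]].
Proof.
have [P [z [[z_ge0 z_out zb] domP]]] := exists_dominant_solution.
have yb i : lhs a (z \o inl) i + z (inr i) = b i.
  by rewrite -lhs_slack_matrix zb.
exists (z \o inl); split=> [x|i|x]; first exact: z_ge0.
  by rewrite -yb lerDl.
have [i x_le] := domP (inl x).
have memP t : 0 < z t -> t \in P by apply: contraTT => /z_out->; rewrite ltxx.
have tight : lhs a (z \o inl) i = b i.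
  rewrite -yb z_out ?addr0 //.
  apply: contraL (slack_rank_gt0 (isT : inl x != inr i)).
  by move=> /x_le; rewrite [slack_rank i (inr i)]/= eqxx leqn0 => /eqP->.
have aix : a i x != 0.
  apply/eqP => aix0; have := b_gt0 i.
  rewrite -tight /lhs big1 ?ltxx // => x' _ /=.
  have [|zx'] := eqVneq (z (inl x')) 0; first by move->; rewrite mulr0.
  have /memP/x_le : 0 < z (inl x') by rewrite lt_neqAle eq_sym zx' z_ge0.
  rewrite /= aix0 eqxx; case: eqP => [->|_]; first by rewrite mul0r.
  by rewrite ltnS leqNgt rank_lt_top.
exists i; split=> //; first by rewrite lt_neqAle eq_sym aix a_ge0.
move=> x' /memP/x_le /[swap] aix'.
by rewrite /= (negbTE aix) gt_eqF.
Qed.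

End GenericRhs.

Lemma scarf_perturbed (b0 : I -> R) (delta : R) :
  (forall i, 0 <= b0 i) -> 0 < delta ->
  exists b y, [/\ forall i, b0 i < b i <= b0 i + delta, forall x, 0 <= y x,
    forall i, lhs a y i <= b i
  & forall x, exists i, [/\ 0 < a i x, lhs a y i = b i
    & forall x', 0 < y x' -> 0 < a i x' -> (rank i x <= rank i x')%N]].
Proof.
move=> b0_ge0 delta_gt0; have [x0 _|X0] := pickP (@predT X); last first.
  exists (fun i => b0 i + delta), (fun=> 0).
  split=> [i|//|i|x]; last by have := X0 x.
    by rewrite ltrDl delta_gt0 lexx.
  rewrite /lhs big1 => [|x]; last by have := X0 x.
  by rewrite addr_ge0 // ltW.
have [b b_gen b_bounds] := exists_generic_rhs slack_matrix b0 delta_gt0.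
have b_gt0 i : 0 < b i by case/andP: (b_bounds i) => /(le_lt_trans (b0_ge0 i)).
have [y [y_ge0 yb y_dom]] := scarf_generic x0 b_gen b_gt0.
by exists b, y.
Qed.

End Scarf.

(** * Greedy hitting sets *)

Lemma exists_le_average (R : realFieldType) (A : finType) (w f : A -> R) :
  (forall a, 0 <= w a) -> \sum_a w a = 1 -> exists c, f c <= \sum_a w a * f a.
Proof.
move=> w_ge0 w_sum; set m := \sum_a w a * f a.
apply/existsP; apply: contraT => /existsPn f_gt.
have gap_ge0 a : 0 <= w a * (f a - m).
  by rewrite mulr_ge0 // subr_ge0 ltW // ltNge f_gt.
have /eqP : \sum_a w a * (f a - m) = 0.
  under eq_bigr do rewrite mulrBr.
  by rewrite sumrB -mulr_suml w_sum mul1r subrr.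
rewrite psumr_eq0 // => /allP w_gap0; have := oner_neq0 R.
rewrite -w_sum big1 ?eqxx // => a _; have := w_gap0 a (mem_index_enum a).
rewrite mulf_eq0 subr_eq0 => /orP[/eqP//|/eqP fa].
by have := f_gt a; rewrite fa lexx.
Qed.

Section GreedyHitting.
Variables (R : realFieldType) (V A : finType) (w : A -> R) (G : V -> {set A}).
Variable beta : R.
Hypothesis w_ge0 : forall a, 0 <= w a.
Hypothesis w_sum : \sum_a w a = 1.
Hypothesis G_mass : forall v, beta <= \sum_(a in G v) w a.

Definition missed (C : {set A}) := [set v | [disjoint C & G v]].

Lemma sum_missed C :
  \sum_c w c * #|missed (c |: C)|%:R =
  \sum_(v in missed C) \sum_(c | c \notin G v) w c.
Proof.
rewrite (exchange_big_dep xpredT) //=; apply: eq_bigr => c _.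
rewrite -sum1_card natr_sum mulr_sumr.
apply: eq_big => [v|v _]; last exact: mulr1.
by rewrite !inE -!setI_eq0 setIUl setU_eq0 !setI_eq0 disjoints1 andbC.
Qed.

Lemma greedy_step C :
  exists c, #|missed (c |: C)|%:R <= (1 - beta) * #|missed C|%:R.
Proof.
have [c c_le] := exists_le_average (fun c => #|missed (c |: C)|%:R) w_ge0 w_sum.
exists c; apply: le_trans c_le _; rewrite sum_missed mulr_natr -sumr_const.
apply: ler_sum => v _; rewrite lerBrDr addrC -w_sum.
by rewrite [leRHS](bigID (mem (G v))) /= lerD2r.
Qed.

Lemma greedy_hitting_set k : beta <= 1 ->
  exists2 C : {set A}, (#|C| <= k)%N &
    #|missed C|%:R <= (1 - beta) ^+ k * #|V|%:R.
Proof.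
move=> beta_le1; elim: k => [|k [C cardC missC]].
  by exists set0; rewrite ?cards0 // expr0 mul1r ler_nat max_card.
have [c missc] := greedy_step C; exists (c |: C).
  by rewrite cardsU1 -add1n leq_add ?leq_b1.
by apply: le_trans missc _; rewrite exprS -mulrA ler_wpM2l // subr_ge0.
Qed.

End GreedyHitting.

(** * Lindahl equilibria *)

Section Upset.
Variables (A : finType) (r : rel A).
Hypothesis lin : strict_linear_order r.

Definition upset a := [set c | (c == a) || r c a].

Lemma mem_upset a : a \in upset a.
Proof. by rewrite inE eqxx. Qed.

Lemma upsetS a b : b \in upset a -> upset b \subset upset a.
Proof.
have [_ [r_trans _]] := lin.
rewrite inE => /predU1P[-> //|ba]; apply/subsetP => c.
rewrite !inE => /predU1P[->|cb]; first by rewrite ba orbT.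
by rewrite (r_trans b) // orbT.
Qed.

Lemma upset_total a b : b \notin upset a -> a \in upset b.
Proof.
have [_ [_ r_total]] := lin; rewrite !inE negb_or => /andP[ba /negbTE nba].
by have := r_total _ _ ba; rewrite nba /= => ->; rewrite orbT.
Qed.

Lemma notin_upset a b : r a b -> b \notin upset a.
Proof.
have [r_irr [r_trans _]] := lin => ab; rewrite inE; apply/norP; split.
  by apply: contraTneq ab => ->; rewrite r_irr.
by apply/negP => ba; have := r_trans _ _ _ ab ba; rewrite r_irr.
Qed.

Lemma card_upset_lt a b : b \notin upset a -> (#|upset a| < #|upset b|)%N.
Proof.
move=> nba; apply: proper_card; apply/properP; split.
  exact/upsetS/upset_total.
by exists b => //; apply: mem_upset.
Qed.

Lemma exists_best (B : {set A}) :
  B != set0 -> exists2 a, a \in B & forall c, c \in B -> a \in upset c.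
Proof.
case/set0Pn => b bB; case: (arg_minnP (fun a => #|upset a|) bB) => a aB a_min.
exists a => // c cB; apply: contraT => /card_upset_lt.
by rewrite ltnNge a_min.
Qed.

Variables (R : realFieldType) (w : A -> R) (beta : R).
Hypothesis w_ge0 : forall a, 0 <= w a.

Definition rejects a := \sum_(c in upset a) w c < beta.

Definition secure := [set c | [forall a, r a c ==> rejects a]].

Lemma secure_mass : beta <= \sum_a w a -> beta <= \sum_(c in secure) w c.
Proof.
move=> w_mass; have [secureT|] := eqVneq (~: secure) set0.
  by rewrite -(setCK secure) secureT setC0 (eq_bigl _ _ (in_setT (T := A))).
case/exists_best => e; rewrite !inE => /forallPn[a]; rewrite negb_imply -leNgt.
case/andP => ae a_mass e_best; apply: le_trans a_mass _.
have sub : upset a \subset secure.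
  apply/subsetP => c ca; apply: contraT => c_insecure.
  have /(subsetP (upsetS ca)) : e \in upset c by rewrite e_best ?in_setC.
  by rewrite (negbTE (notin_upset ae)).
by rewrite [leRHS](big_setID (upset a)) /= (setIidPr sub) lerDl sumr_ge0.
Qed.

End Upset.

Lemma exists_probability_ge (R : realFieldType) (A : finType) (u : A -> R) :
  (0 < #|A|)%N -> \sum_a u a <= 1 ->
  exists2 w, forall a, u a <= w a & \sum_a w a = 1.
Proof.
case/card_gt0P => a0 _ u_sum.
exists (fun a => u a + (if a == a0 then 1 - \sum_c u c else 0)) => [a|].
  by rewrite lerDl; case: ifP; rewrite ?subr_ge0.
by rewrite big_split -big_mkcond big_pred1_eq /= subrKC.
Qed.

Section Lindahl.
Variables (R : archiRealFieldType) (V A : finType) (pref : V -> rel A).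
Variable beta : R.
Hypothesis elec : election pref.
Hypothesis beta_ge0 : 0 <= beta.

Definition rejecting (w : A -> R) a := [set v | rejects (pref v) w beta a].

Definition lindahl_equilibrium (w : A -> R) :=
  [/\ forall a, 0 <= w a, \sum_a w a = 1
    & forall a, #|rejecting w a|%:R <= beta * #|V|%:R].

Let quota := (Num.truncn (beta * #|V|%:R)).+1.

Definition coalition := {S : {set V} | (quota <= #|S|)%N}.

Definition coalition_matrix (v : V) (x : A * coalition) : R :=
  (v \in val x.2)%:R.

Definition candidate_weight (y : A * coalition -> R) a := \sum_S y (a, S).

Lemma sum_candidate_coalition (F : A * coalition -> R) :
  \sum_x F x = \sum_c \sum_S F (c, S).
Proof. by rewrite pair_bigA; apply: eq_bigr => -[]. Qed.

Lemma sum_candidate_weight y (b : V -> R) : (forall x, 0 <= y x) ->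
  (forall v, lhs coalition_matrix y v <= b v) ->
  quota%:R * \sum_a candidate_weight y a <= \sum_v b v.
Proof.
move=> y_ge0 yb.
have : \sum_v lhs coalition_matrix y v <= \sum_v b v by apply: ler_sum.
apply: le_trans; rewrite -sum_candidate_coalition.
rewrite /lhs [leRHS]exchange_big mulr_sumr; apply: ler_sum => x _.
rewrite -mulr_suml ler_wpM2r // -natr_sum ler_nat.
apply: leq_trans (valP x.2) _; rewrite -sum1_card big_mkcond /=.
by apply: leq_sum => v _; case: (v \in _).
Qed.

Lemma lhs_coalition_upset y v a : (forall x, 0 <= y x) ->
  (forall x, 0 < y x -> 0 < coalition_matrix v x -> x.1 \in upset (pref v) a) ->
  lhs coalition_matrix y v <= \sum_(c in upset (pref v) a) candidate_weight y c.
Proof.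
move=> y_ge0 y_upset; rewrite /lhs sum_candidate_coalition.
rewrite [leRHS]big_mkcond; apply: ler_sum => c _; have [ca|ca] := ifPn.
  by apply: ler_sum => S _; rewrite ler_piMl // lern1 leq_b1.
rewrite big1 // => S _; apply/eqP; rewrite mulf_eq0 -[_ || _]negbK negb_or.
apply: contra ca => /andP[aS yS].
by apply: (y_upset (c, S)); rewrite lt_neqAle eq_sym ?aS ?yS ?y_ge0 ?ler0n.
Qed.

(* The rows ration each voter to mass about beta, and a unit of mass is charged
   to at least quota > beta n voters, so the total mass is at most 1. *)
Lemma exists_coalition_solution : exists y : A * coalition -> R,
  [/\ forall x, 0 <= y x, \sum_a candidate_weight y a <= 1
    & forall x : A * coalition, exists v,
      [/\ v \in val x.2, beta <= lhs coalition_matrix y v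
        & forall x', 0 < y x' -> 0 < coalition_matrix v x' ->
          x'.1 \in upset (pref v) x.1]].
Proof.
have [V_gt0 [_ lin]] := elec; have n_gt0 : 0 < #|V|%:R :> R by rewrite ltr0n.
pose delta := (quota%:R - beta * #|V|%:R) / #|V|%:R.
have delta_gt0 : 0 < delta by rewrite divr_gt0 // subr_gt0 truncnS_gt.
pose rank v (x : A * coalition) := #|~: upset (pref v) x.1|.
have matrix_ge0 v x : 0 <= coalition_matrix v x by rewrite ler0n.
have matrix_col x : exists v, 0 < coalition_matrix v x.
  have /card_gt0P[v vS] := leq_trans (ltn0Sn _) (valP x.2).
  by exists v; rewrite /coalition_matrix vS ltr01.
have [b [y [b_bounds y_ge0 yb y_dom]]] :=
  scarf_perturbed rank matrix_ge0 matrix_col (fun=> beta_ge0) delta_gt0.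
exists y; split=> // [|x].
  have := sum_candidate_weight y_ge0 yb.
  rewrite -ler_pdivlMl ?ltr0n // => /le_trans; apply.
  rewrite ler_pdivrMl ?ltr0n // mulr1.
  apply: le_trans (_ : _ <= \sum_(v : V) (beta + delta)) _.
    by apply: ler_sum => v _; case/andP: (b_bounds v).
  by rewrite sumr_const -[leLHS]mulr_natr mulrDl divfK ?gt_eqF // addrC subrK.
have [v [vx tight v_dom]] := y_dom x; exists v; split.
- by move: vx; rewrite /coalition_matrix; case: (v \in _); rewrite ?ltxx.
- by rewrite tight ltW //; case/andP: (b_bounds v).
move=> x' yx' vx'; apply: contraT => /(card_upset_lt (lin v)) upset_lt.
have := v_dom x' yx' vx'; rewrite /rank.
have := cardsC (upset (pref v) x.1); have := cardsC (upset (pref v) x'.1); lia.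
Qed.

Lemma exists_lindahl_equilibrium : exists w, lindahl_equilibrium w.
Proof.
have [y [y_ge0 y_sum y_dom]] := exists_coalition_solution.
have [w w_ge w_sum] := exists_probability_ge elec.2.1 y_sum.
exists w; split=> // a.
  by apply: le_trans (w_ge a); apply: sumr_ge0.
rewrite -truncn_ge_nat ?mulr_ge0 // leqNgt; apply/negP => large.
have [v [v_rej mass v_dom]] := y_dom (a, exist _ (rejecting w a) large).
move: v_rej; rewrite inE /rejects ltNge => /negP[]; apply: le_trans mass _.
apply: le_trans (lhs_coalition_upset y_ge0 v_dom) _.
by apply: ler_sum => c _; apply: w_ge.
Qed.

End Lindahl.

Lemma leq_card_prefers_to_set (R : archiRealFieldType) (V A : finType)
    (pref : V -> rel A) (beta : R) (w : A -> R) a (C : {set A}) :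
  (#|[set v | prefers_to_set pref v a C]| <=
   #|rejecting pref beta w a| +
   #|missed (fun v => secure (pref v) w beta) C|)%N.
Proof.
apply: leq_trans (leq_card_setU _ _); apply/subset_leq_card/subsetP => v.
rewrite !inE => /forall_inP aC.
have [//|accept] := boolP (rejects _ _ _ _).
rewrite disjoint_subset; apply/subsetP => c /aC ac; rewrite !inE.
by apply/forallPn; exists a; rewrite ac.
Qed.

Theorem theorem1 (R : realType) (V A : finType) (pref : V -> rel A)
  (k : nat) (beta : R) :
  election pref -> (1 <= k)%N -> 0 <= beta -> beta <= 1 ->
  exists C : {set A}, (#|C| <= k)%N /\
    undominated pref (beta + (1 - beta) ^+ k) C.
Proof.
move=> elec _ beta_ge0 beta_le1.
have [w [w_ge0 w_sum rejecting_le]] := exists_lindahl_equilibrium elec beta_ge0.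
have secure_ge v : beta <= \sum_(a in secure (pref v) w beta) w a.
  by apply: secure_mass; rewrite ?w_sum //; case: elec => _ [].
have [C cardC missed_le] := greedy_hitting_set w_ge0 w_sum secure_ge k beta_le1.
exists C; split=> // a _; rewrite floor_ge_int mulrDl.
apply: le_trans (lerD (rejecting_le a) missed_le).
by rewrite -natrD ler_nat leq_card_prefers_to_set.
Qed.
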